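(* Let $2<\tau<3$, $0<h_{\min}<N$, let $a,b$ satisfy $0<ah_{\min}\le ah_{\min}b\le 1\le b<\infty$ and $ah_{\min}<b$, and let $f$ belong to the F-class (i.e. satisfy F1–F4 listed in the context). Then for all $u_0\ge1$, $$C_{ab}^{f}(\tau)\;\ge\;u_0f(u_0)\,C_{a_0b_0}^{\max}(\tau),\qquad a_0=\frac{a}{\sqrt{u_0}},\quad b_0=\frac{b}{\sqrt{u_0}}.$$
   Context: The F-class consists of all functions $f:[0,\infty)\to(0,1]$ satisfying the following (monotonicity is in the weak sense): F1: $f(0)=1$ and $f(u)$ decreases to $0$ as $u\to\infty$. F2: $r(u)=uf(u)$ increases to $1$ as $u\to\infty$. F3: $f$ is continuous and there are finitely many points $0=u_0<u_1<\dots<u_K<\infty$ such that $f$ is twice differentiable on each of the closed intervals $[u_{k-1},u_k]$ and on $[u_K,\infty)$ (one-sided derivatives at the endpoints); by convention $f'(u_k)=\frac12 f'(u_k+0)+\frac12 f'(u_k-0)$ for $k=1,\dots,K$ and $f'(0)=f'(+0)$. (The breakpoints $u_k$ here are unrelated to the number $u_0\ge1$ in the claim.) F4: $-uf'(u)/f(u)$ is increasing in $u\ge0$. Let $\rho(h)=h^{-\tau}\big/\int_{h_{\min}}^{N}t^{-\tau}\,dt$ on $[h_{\min},N]$ and $A(\tau)=\int_{h_{\min}}^{N}\rho(h)\big(1-(1+h)e^{-h}\big)\,dh$. For any $a,b>0$ with $ah_{\min}<b$ define $$C_{ab}^{f}(\tau)=A(\tau)\,\frac{\int_{ah_{\min}}^{b}\int_{ah_{\min}}^{b}(xy)^{2-\tau}f(xy)\,dx\,dy}{\Big(\int_{ah_{\min}}^{b}x^{1-\tau}\,dx\Big)^2},$$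 and let $C_{ab}^{\max}(\tau)=C_{ab}^{f_{\max}}(\tau)$ with $f_{\max}(u)=\min(1,1/u)$, $u\ge0$ (with $f_{\max}(0)=1$). *)

(* Defs.v *)
(* Stdlib reals and Coquelicot *)
From Stdlib Require Import Reals Lra.
From Coquelicot Require Import Coquelicot.
Open Scope R_scope.

(* Functions on [0, oo) are represented by functions R -> R of which only the
   values on [0, oo) are constrained or used. *)
Definition nonneg_decreasing (g : R -> R) : Prop :=
  forall u v : R, 0 <= u -> u <= v -> g v <= g u.

Definition nonneg_increasing (g : R -> R) : Prop :=
  forall u v : R, 0 <= u -> u <= v -> g u <= g v.

(* Derivative at x of the restriction of g to D; it is a one-sided derivative
   when D is an interval and x one of its endpoints. *)
Definition is_derive_within (D : R -> Prop) (g : R -> R) (x l : R) : Prop :=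
  filterlim (fun y => (g y - g x) / (y - x))
    (within D (locally' x)) (locally l).

Definition twice_differentiable_on (D : R -> Prop) (g : R -> R) : Prop :=
  exists g1 : R -> R,
    (forall x, D x -> is_derive_within D g x (g1 x)) /\
    (forall x, D x -> exists l : R, is_derive_within D g1 x l).

(* f'(x + 0) and f'(x - 0), with an unspecified value if they do not exist. *)
Definition right_derivative (g : R -> R) (x : R) : R :=
  iota (fun l : R => is_derive_within (fun y => x <= y) g x l).

Definition left_derivative (g : R -> R) (x : R) : R :=
  iota (fun l : R => is_derive_within (fun y => y <= x) g x l).

(* The convention for f' at the breakpoints and at 0. Averaging the one-sided
   derivatives at every u > 0 makes the definition independent of the choice
   of breakpoints, and gives the usual f'(u) wherever f is differentiable. *)
Definition mid_derivative (g : R -> R) (u : R) : R :=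
  if Req_EM_T u 0 then right_derivative g 0
  else 1 / 2 * right_derivative g u + 1 / 2 * left_derivative g u.

Definition piecewise_twice_differentiable (g : R -> R) : Prop :=
  exists (K : nat) (u : nat -> R),
    u 0%nat = 0 /\
    (forall k : nat, (k < K)%nat -> u k < u (S k)) /\
    (forall k : nat, (k < K)%nat ->
       twice_differentiable_on (fun x => u k <= x <= u (S k)) g) /\
    twice_differentiable_on (fun x => u K <= x) g.

Record F_class (f : R -> R) : Prop := {
  F_range : forall u : R, 0 <= u -> 0 < f u <= 1;
  F1_zero : f 0 = 1;
  F1_decreasing : nonneg_decreasing f;
  F1_limit : is_lim f p_infty 0;
  F2_increasing : nonneg_increasing (fun u => u * f u);
  F2_limit : is_lim (fun u => u * f u) p_infty 1;
  F3_continuous : continuous_on (fun u => 0 <= u) f;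
  F3_smooth : piecewise_twice_differentiable f;
  F4 : nonneg_increasing (fun u => - u * mid_derivative f u / f u)
}.

Definition f_max (u : R) : R :=
  if Req_EM_T u 0 then 1 else Rmin 1 (1 / u).

Definition rho (hmin N tau h : R) : R :=
  Rpower h (- tau) / RInt (fun t => Rpower t (- tau)) hmin N.

Definition A (hmin N tau : R) : R :=
  RInt (fun h => rho hmin N tau h * (1 - (1 + h) * exp (- h))) hmin N.

Definition C_ab (hmin N : R) (f : R -> R) (a b tau : R) : R :=
  A hmin N tau *
  (RInt (fun x =>
     RInt (fun y => Rpower (x * y) (2 - tau) * f (x * y)) (a * hmin) b)
     (a * hmin) b
   / (RInt (fun x => Rpower x (1 - tau)) (a * hmin) b) ^ 2).

(* Main.v *)
Require Import Defs.
From Stdlib Require Import Reals Lra.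
From Coquelicot Require Import Coquelicot.
Open Scope R_scope.

(** Rescaling both variables by [sqrt u0] turns the two quotients into integrals
    over the same square, and the claim into
      [int int (x y)^(2-tau) f (x y) >=
         f u0 * int int (x y)^(2-tau) f_max (x y / u0)].
    This already holds for the integrands: [f u >= f u0 * f_max (u / u0)] for
    every [u > 0] ([F_class_ge_f_max]), by the monotonicity of [f] when
    [u <= u0] and by that of [u f u] when [u >= u0].

    The analytic content is that the iterated integrals exist, so that they can
    be rescaled ([mul_RInt2_dilate]) and compared ([mul_RInt2_le]).  Since the
    integrands depend on [x y] only, the inner integral is
    [(1/x) * int_{c x}^{b x} g], which is continuous in [x] as soon as [g] is
    continuous on the positive half-line ([mul_RInt_continuous]). *)

Definition continuous_pos (g : R -> R) : Prop :=
  forall x, 0 < x -> continuous g x.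

Definition mul_RInt2 (g : R -> R) (c b : R) : R :=
  RInt (fun x => RInt (fun y => g (x * y)) c b) c b.

(** * Integrals of functions continuous on the positive half-line *)

Lemma continuous_pos_ex_RInt (g : R -> R) (c b : R) :
  continuous_pos g -> 0 < c -> c <= b -> ex_RInt g c b.
Proof.
  intros Hg Hc Hcb; apply (ex_RInt_continuous g); intros z Hz; apply Hg.
  rewrite Rmin_left in Hz; lra.
Qed.

Lemma continuous_pos_mult (g1 g2 : R -> R) :
  continuous_pos g1 -> continuous_pos g2 ->
  continuous_pos (fun x => g1 x * g2 x).
Proof.
  intros H1 H2 x Hx; apply (continuous_mult g1 g2 x); auto.
Qed.

Lemma continuous_pos_dilate (g : R -> R) (k : R) :
  0 < k -> continuous_pos g -> continuous_pos (fun x => g (k * x)).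
Proof.
  intros Hk Hg x Hx; apply (continuous_comp (fun x => k * x) g).
  - apply (ex_derive_continuous (fun x => k * x)); auto_derive; exact I.
  - apply Hg, Rmult_lt_0_compat; assumption.
Qed.

Lemma continuous_pos_Rpower (e : R) : continuous_pos (fun x => Rpower x e).
Proof.
  intros x Hx; apply (ex_derive_continuous (fun x => Rpower x e)).
  exists (e * Rpower x (e - 1)).
  apply is_derive_Reals, derivable_pt_lim_power, Hx.
Qed.

Lemma RInt_mult_l (g : R -> R) (m c b : R) :
  ex_RInt g c b -> RInt (fun x => m * g x) c b = m * RInt g c b.
Proof.
  exact (RInt_scal g c b m).
Qed.

Lemma RInt_dilate (g : R -> R) (k c b : R) :
  ex_RInt g (k * c) (k * b) ->
  RInt g (k * c) (k * b) = RInt (fun x => k * g (k * x)) c b.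
Proof.
  intros Hg.
  pose proof (RInt_comp_lin g k 0 c b) as H.
  rewrite !Rplus_0_r in H; rewrite <- (H Hg); apply RInt_ext; intros x _.
  now rewrite Rplus_0_r.
Qed.

Lemma mul_RInt_eq (g : R -> R) (c b x : R) :
  continuous_pos g -> 0 < c -> c <= b -> 0 < x ->
  RInt (fun y => g (x * y)) c b =
  / x * (RInt g c (x * b) - RInt g c (x * c)).
Proof.
  intros Hg Hc Hcb Hx.
  assert (Hint : forall p q, 0 < p -> 0 < q -> ex_RInt g p q).
  { intros p q Hp Hq; apply (ex_RInt_continuous g); intros z Hz; apply Hg.
    pose proof (Rmin_glb_lt p q 0 Hp Hq); lra. }
  pose proof (Rmult_lt_0_compat x c Hx Hc).
  assert (0 < x * b) by (apply Rmult_lt_0_compat; lra).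
  assert (Hch : RInt g c (x * c) + RInt g (x * c) (x * b) = RInt g c (x * b))
    by (apply (RInt_Chasles g); auto).
  rewrite <- Hch, RInt_dilate by auto.
  rewrite (RInt_mult_l (fun y => g (x * y)))
    by (apply continuous_pos_ex_RInt; auto; now apply continuous_pos_dilate).
  rewrite Rplus_minus_l, <- Rmult_assoc, Rinv_l, Rmult_1_l; [ reflexivity | lra ].
Qed.

(** The closed form of [mul_RInt_eq] makes this an instance of the fundamental
    theorem of calculus instead of a two-variable continuity argument. *)
Lemma mul_RInt_continuous (g : R -> R) (c b : R) :
  continuous_pos g -> 0 < c -> c <= b ->
  continuous_pos (fun x => RInt (fun y => g (x * y)) c b).
Proof.
  intros Hg Hc Hcb.
  assert (HG : continuous_pos (fun v => RInt g c v)).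
  { intros v Hv.
    apply (ex_derive_continuous (fun v => RInt g c v)); exists (g v).
    apply (is_derive_RInt g (fun v => RInt g c v) c v); [ | now apply Hg].
    apply (filter_imp (fun y => 0 < y)); [ | now apply (open_gt 0)].
    intros y Hy; apply (RInt_correct g), (ex_RInt_continuous g).
    intros z Hz; apply Hg; pose proof (Rmin_glb_lt c y 0 Hc Hy); lra. }
  assert (HGd : forall k, 0 < k -> continuous_pos (fun x => RInt g c (x * k))).
  { intros k Hk x Hx.
    apply (continuous_ext (fun x => RInt g c (k * x))).
    - intros y; now rewrite Rmult_comm.
    - now apply (continuous_pos_dilate (fun v => RInt g c v)). }
  intros x Hx.
  apply (continuous_ext_loc _
           (fun x => / x * (RInt g c (x * b) - RInt g c (x * c)))).
  { apply (filter_imp (fun y => 0 < y)); [ | now apply (open_gt 0)].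
    intros y Hy; symmetry; now apply mul_RInt_eq. }
  apply (continuous_mult (fun x => / x)).
  - apply continuous_Rinv; lra.
  - apply (continuous_minus (fun x => RInt g c (x * b))); apply HGd; lra.
Qed.

(** * Iterated integrals of functions of the product *)

Lemma mul_RInt2_le (g1 g2 : R -> R) (c b : R) :
  continuous_pos g1 -> continuous_pos g2 -> 0 < c -> c <= b ->
  (forall u, 0 < u -> g1 u <= g2 u) ->
  mul_RInt2 g1 c b <= mul_RInt2 g2 c b.
Proof.
  intros H1 H2 Hc Hcb Hle; unfold mul_RInt2.
  apply RInt_le; [ assumption | | | intros x Hx; apply RInt_le; [assumption | | | ] ].
  1,2: apply continuous_pos_ex_RInt; auto; now apply mul_RInt_continuous.
  1,2: apply continuous_pos_ex_RInt; auto; apply continuous_pos_dilate; auto; lra.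
  intros y Hy; apply Hle, Rmult_lt_0_compat; lra.
Qed.

Lemma mul_RInt2_scal (g : R -> R) (m c b : R) :
  continuous_pos g -> 0 < c -> c <= b ->
  mul_RInt2 (fun u => m * g u) c b = m * mul_RInt2 g c b.
Proof.
  intros Hg Hc Hcb; unfold mul_RInt2.
  transitivity (RInt (fun x => m * RInt (fun y => g (x * y)) c b) c b).
  - apply RInt_ext; intros x Hx.
    rewrite Rmin_left in Hx by assumption.
    apply (RInt_mult_l (fun y => g (x * y))), continuous_pos_ex_RInt; auto.
    apply continuous_pos_dilate; auto; lra.
  - apply (RInt_mult_l (fun x => RInt (fun y => g (x * y)) c b)).
    apply continuous_pos_ex_RInt; auto; now apply mul_RInt_continuous.
Qed.

Lemma mul_RInt2_dilate (g : R -> R) (k c b : R) :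
  continuous_pos g -> 0 < k -> 0 < c -> c <= b ->
  mul_RInt2 g (k * c) (k * b) =
  k ^ 2 * mul_RInt2 (fun u => g (k ^ 2 * u)) c b.
Proof.
  intros Hg Hk Hc Hcb.
  assert (Hk2 : 0 < k ^ 2) by (apply pow_lt; assumption).
  assert (Hkc : 0 < k * c) by (apply Rmult_lt_0_compat; assumption).
  assert (Hkcb : k * c <= k * b) by (apply Rmult_le_compat_l; lra).
  rewrite <- mul_RInt2_scal; auto; [ | now apply continuous_pos_dilate ].
  unfold mul_RInt2 at 1.
  rewrite RInt_dilate
    by (apply continuous_pos_ex_RInt; auto; now apply mul_RInt_continuous).
  unfold mul_RInt2; apply RInt_ext; intros x Hx.
  rewrite Rmin_left in Hx by assumption.
  assert (Hkx : 0 < k * x) by (apply Rmult_lt_0_compat; lra).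
  assert (Hgx : continuous_pos (fun y => g (k * x * y)))
    by now apply continuous_pos_dilate.
  rewrite (RInt_dilate (fun y => g (k * x * y)))
    by (apply continuous_pos_ex_RInt; auto).
  assert (Hcont : continuous_pos (fun y => k * g (k * x * (k * y)))).
  { apply (continuous_pos_mult (fun _ => k)).
    - intros z _; apply continuous_const.
    - now apply (continuous_pos_dilate (fun y => g (k * x * y))). }
  rewrite <- RInt_mult_l
    by (apply continuous_pos_ex_RInt; auto).
  apply RInt_ext; intros y _; simpl.
  replace (k * x * (k * y)) with (k * (k * 1) * (x * y)) by ring; ring.
Qed.

(** * The power weight and the constant A *)

Lemma RInt_Rpower_pos (e c b : R) :
  0 < c -> c < b -> 0 < RInt (fun x => Rpower x e) c b.
Proof.
  intros Hc Hcb; apply RInt_gt_0; auto.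
  - intros x _; apply exp_pos.
  - intros x Hx; apply continuous_pos_Rpower; lra.
Qed.

Lemma RInt_Rpower_dilate (e k c b : R) :
  0 < k -> 0 < c -> c <= b ->
  RInt (fun x => Rpower x e) (k * c) (k * b) =
  k * Rpower k e * RInt (fun x => Rpower x e) c b.
Proof.
  intros Hk Hc Hcb.
  rewrite RInt_dilate.
  2: { apply continuous_pos_ex_RInt.
       - apply continuous_pos_Rpower.
       - now apply Rmult_lt_0_compat.
       - apply Rmult_le_compat_l; lra. }
  rewrite <- RInt_mult_l
    by (apply continuous_pos_ex_RInt; auto; apply continuous_pos_Rpower).
  apply RInt_ext; intros x Hx; rewrite Rmin_left in Hx by assumption.
  rewrite <- Rpower_mult_distr by lra; now rewrite Rmult_assoc.
Qed.

Lemma A_nonneg (hmin N tau : R) : 0 < hmin < N -> 0 <= A hmin N tau.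
Proof.
  intros HhN; unfold A, rho.
  pose proof (RInt_Rpower_pos (- tau) hmin N ltac:(lra) ltac:(lra)) as HD.
  set (D := RInt _ _ _) in *.
  apply RInt_ge_0; [ lra | | ].
  - apply continuous_pos_ex_RInt; [ | lra | lra ].
    apply (continuous_pos_mult (fun h => Rpower h (- tau) / D)).
    + apply (continuous_pos_mult (fun h => Rpower h (- tau)) (fun _ => / D)).
      * apply continuous_pos_Rpower.
      * intros x _; apply continuous_const.
    + intros x _.
      apply (ex_derive_continuous (fun h => 1 - (1 + h) * exp (- h))).
      auto_derive; exact I.
  - intros h Hh; apply Rmult_le_pos.
    + apply Rlt_le, Rdiv_lt_0_compat; [ apply exp_pos | exact HD ].
    + assert (Hexp : (1 + h) * exp (- h) <= exp h * exp (- h)).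
      { apply Rmult_le_compat_r; [ apply Rlt_le, exp_pos | ].
        apply Rlt_le, exp_ineq1; lra. }
      rewrite <- exp_plus, Rplus_opp_r, exp_0 in Hexp; lra.
Qed.

(** * The F-class *)

Lemma F_class_continuous_pos (f : R -> R) : F_class f -> continuous_pos f.
Proof.
  intros Hf x Hx.
  apply (continuous_continuous_on (fun u => 0 <= u)).
  - apply (filter_imp (fun y => 0 < y)); [ | now apply (open_gt 0) ].
    intros y Hy; lra.
  - apply F3_continuous, Hf.
Qed.

Lemma f_max_continuous_pos : continuous_pos f_max.
Proof.
  intros x Hx.
  apply (continuous_ext_loc _
           (fun u => / 2 * (1 + / u - Rabs (1 - / u)))).
  { apply (filter_imp (fun y => 0 < y)); [ | now apply (open_gt 0) ].
    intros y Hy; unfold f_max; destruct (Req_EM_T y 0); [ lra | ].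
    unfold Rmin, Rdiv, Rabs; destruct (Rle_dec _ _), (Rcase_abs _); lra. }
  assert (Hinv : continuous (fun u => / u) x) by (apply continuous_Rinv; lra).
  apply (continuous_mult (fun _ => / 2)); [ apply continuous_const | ].
  apply (continuous_minus (fun u => 1 + / u) (fun u => Rabs (1 - / u))).
  - apply (continuous_plus (fun _ => 1)); [ apply continuous_const | exact Hinv ].
  - apply (continuous_comp (fun u => 1 - / u) Rabs).
    + apply (continuous_minus (fun _ => 1)); [ apply continuous_const | exact Hinv ].
    + apply continuous_Rabs.
Qed.

(** Rescaled in both axes so as to meet [f] at [u0], [f_max] is the smallest function
    allowed by the two monotonicity conditions: constant before [u0], and
    proportional to [1 / u] after it. *)
Lemma F_class_ge_f_max (f : R -> R) (u0 u : R) :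
  F_class f -> 0 < u0 -> 0 < u -> f u0 * f_max (/ u0 * u) <= f u.
Proof.
  intros Hf Hu0 Hu.
  assert (Hv : 0 < / u0 * u)
    by (apply Rmult_lt_0_compat; [ now apply Rinv_0_lt_compat | assumption ]).
  assert (Hfu0 : 0 < f u0) by (apply (F_range f Hf); lra).
  unfold f_max; destruct (Req_EM_T (/ u0 * u) 0); [ lra | ].
  destruct (Rle_lt_dec u u0) as [Hle | Hlt].
  - apply Rle_trans with (f u0 * 1).
    + apply Rmult_le_compat_l; [ lra | apply Rmin_l ].
    + rewrite Rmult_1_r; apply (F1_decreasing f Hf); lra.
  - apply Rle_trans with (f u0 * (1 / (/ u0 * u))).
    + apply Rmult_le_compat_l; [ lra | apply Rmin_r ].
    + pose proof (F2_increasing f Hf u0 u ltac:(lra) ltac:(lra)) as H.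
      simpl in H.
      apply Rmult_le_reg_l with u; [ assumption | ].
      replace (u * (f u0 * (1 / (/ u0 * u)))) with (u0 * f u0); [ exact H | ].
      field; lra.
Qed.

Theorem proposition4 (tau hmin N a b : R) (f : R -> R)
  (Htau : 2 < tau < 3)
  (HhN : 0 < hmin < N)
  (Hah : 0 < a * hmin <= a * hmin * b)
  (Hahb : a * hmin * b <= 1 <= b)
  (Hab : a * hmin < b)
  (Hf : F_class f) :
  forall u0 : R, 1 <= u0 ->
    C_ab hmin N f a b tau >=
      u0 * f u0 * C_ab hmin N f_max (a / sqrt u0) (b / sqrt u0) tau.
Proof.
  intros u0 Hu0.
  assert (Hs : 0 < sqrt u0) by (apply sqrt_lt_R0; lra).
  set (k := / sqrt u0).
  assert (Hk : 0 < k) by now apply Rinv_0_lt_compat.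
  assert (Hk2 : k ^ 2 = / u0).
  { unfold k; rewrite pow_inv, pow2_sqrt; lra. }
  unfold C_ab.
  set (c := a * hmin) in *.
  replace (a / sqrt u0 * hmin) with (k * c) by (unfold k, c, Rdiv; ring).
  replace (b / sqrt u0) with (k * b) by (unfold k, Rdiv; ring).
  set (e := 2 - tau).
  set (g := fun v => Rpower v e * f v).
  set (gm := fun v => Rpower v e * f_max v).
  change (RInt (fun x => RInt (fun y => Rpower (x * y) e * f (x * y)) c b) c b)
    with (mul_RInt2 g c b).
  change (RInt (fun x => RInt (fun y => Rpower (x * y) e * f_max (x * y))
                  (k * c) (k * b)) (k * c) (k * b))
    with (mul_RInt2 gm (k * c) (k * b)).
  assert (Hg : continuous_pos g).
  { apply continuous_pos_mult;
      [ apply continuous_pos_Rpower | now apply F_class_continuous_pos ]. }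
  assert (Hgm : continuous_pos gm).
  { apply continuous_pos_mult;
      [ apply continuous_pos_Rpower | apply f_max_continuous_pos ]. }
  assert (Hk2pos : 0 < k ^ 2) by now apply pow_lt.
  assert (Hgmk : continuous_pos (fun u => gm (k ^ 2 * u)))
    by now apply continuous_pos_dilate.
  rewrite mul_RInt2_dilate, RInt_Rpower_dilate by lra || assumption.
  pose proof (RInt_Rpower_pos (1 - tau) c b ltac:(lra) Hab) as HD.
  set (D := RInt _ c b) in *.
  set (J := mul_RInt2 g c b).
  set (Jm := mul_RInt2 (fun u => gm (k ^ 2 * u)) c b).
  set (P := Rpower (k ^ 2) e).
  assert (HP : 0 < P) by apply exp_pos.
  (* The factor by which the squared denominator changes is also the one that
     comes out of the power weight in the numerator. *)
  assert (HPk : (k * Rpower k (1 - tau)) ^ 2 = P).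
  { unfold P, e.
    replace (2 - tau) with (1 + (1 - tau)) by ring.
    rewrite Rpower_plus, Rpower_1 by assumption.
    simpl; rewrite !Rmult_1_r, <- (Rpower_mult_distr k k) by assumption; ring. }
  assert (HJ : f u0 * Jm <= P * J).
  { unfold J, Jm; rewrite <- !mul_RInt2_scal by lra || assumption.
    apply mul_RInt2_le; try lra.
    1: apply (continuous_pos_mult (fun _ => f u0)); [ | exact Hgmk ].
    2: apply (continuous_pos_mult (fun _ => P)); [ | exact Hg ].
    1,2: intros x _; apply continuous_const.
    intros u Hu; unfold g, gm.
    rewrite <- Rpower_mult_distr by assumption; fold P.
    replace (f u0 * (P * Rpower u e * f_max (k ^ 2 * u)))
      with (P * (Rpower u e * (f u0 * f_max (k ^ 2 * u)))) by ring.
    apply Rmult_le_compat_l; [ lra | ].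
    apply Rmult_le_compat_l; [ apply Rlt_le, exp_pos | ].
    rewrite Hk2; apply F_class_ge_f_max; auto; lra. }
  rewrite (Rpow_mult_distr _ D 2), HPk, Hk2.
  apply Rle_ge.
  replace (u0 * f u0 * (A hmin N tau * (/ u0 * Jm / (P * D ^ 2))))
    with (A hmin N tau * (f u0 * Jm / (P * D ^ 2))) by (field; lra).
  apply Rmult_le_compat_l; [ now apply A_nonneg | ].
  replace (J / D ^ 2) with (P * J / (P * D ^ 2)) by (field; lra).
  apply Rmult_le_compat_r; [ | exact HJ ].
  apply Rlt_le, Rinv_0_lt_compat, Rmult_lt_0_compat;
    [ assumption | now apply pow_lt ].
Qed.
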